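(* Let $(\overline{\mathcal{X}},d)$ be a Polish metric space, $x_0\in\overline{\mathcal{X}}$ a fixed reference point, and $p\ge1$. Let $\bm{x}_{n+1}=\bm{\Phi}(\bm{x}_n)$ be a deterministic dynamical system preserving a probability measure $\mu$, let $\overline{(\cdot)}$ be a coarse-graining map into $\overline{\mathcal{X}}$, let $\bar\mu$ be the pushforward of $\mu$ under $\overline{(\cdot)}$, and assume $\bar\mu\in\mathcal{P}_p(\overline{\mathcal{X}})$. Let $\bm{x}_n\sim\mu$ (so $\overline{\bm{x}}_n\sim\bar\mu$), and let $Q_m(\cdot\mid\overline{\bm{x}}_n)=\mathbb{P}(\overline{\bm{x}}_{n+m}\in\cdot\mid\overline{\bm{x}}_n)$. Assume that for $\bar\mu$-almost every $\overline{\bm{x}}_n$, $$Q_m(\cdot\mid\overline{\bm{x}}_n)\xrightarrow{W_p}\bar\mu\qquad\text{as }m\to\infty.$$ Consider a Markovian model $\widetilde{\bm{x}}_{n+k+1}=\bm{F}_{\bm{\theta}}(\widetilde{\bm{x}}_{n+k},\bm{\xi}_{n+k})$, $k\ge0$, with $\widetilde{\bm{x}}_n=\overline{\bm{x}}_n$ and noise variables independent of each other and of $\bm{x}_n$, and let $\widetilde{\mathbb{P}}_{\bm{\theta},m}(\cdot\mid\overline{\bm{x}}_n)\in\mathcal{P}_p(\overline{\mathcal{X}})$ be its $m$-step conditional predictive measure (the conditional law of $\widetilde{\bm{x}}_{n+m}$ given $\overline{\bm{x}}_n$). Assume that for $\bar\mu$-almost every $\overline{\bm{x}}_n$, $$\widetilde{\mathbb{P}}_{\bm{\theta},m}(\cdot\mid\overline{\bm{x}}_n)\xrightarrow{W_p}\widetilde{\mathbb{P}}_{\bm{\theta},\infty}(\cdot\mid\overline{\bm{x}}_n)\qquad\text{as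 }m\to\infty.$$ Let $\ell:\overline{\mathcal{X}}\times\overline{\mathcal{X}}\to\mathbb{R}$ be continuous and satisfy, for some constant $C>0$ and all $\widetilde{\bm{y}},\overline{\bm{y}}\in\overline{\mathcal{X}}$, $$|\ell(\widetilde{\bm{y}},\overline{\bm{y}})|\le C\big(1+d(\widetilde{\bm{y}},x_0)^p+d(\overline{\bm{y}},x_0)^p\big),$$ and assume that the functional $$(P,Q)\mapsto\int_{\overline{\mathcal{X}}}\int_{\overline{\mathcal{X}}}\ell(\widetilde{\bm{y}},\overline{\bm{y}})\,\mathrm{d}P(\widetilde{\bm{y}})\,\mathrm{d}Q(\overline{\bm{y}})$$ is jointly continuous with respect to $W_p\times W_p$ on $\mathcal{P}_p(\overline{\mathcal{X}})\times\mathcal{P}_p(\overline{\mathcal{X}})$. Define the climatological risk $R(\bm{c})=\mathbb{E}_{\overline{\bm{y}}\sim\bar\mu}[\ell(\bm{c},\overline{\bm{y}})]$ for $\bm{c}\in\overline{\mathcal{X}}$, and assume that $R$ has a unique global minimizer $\bm{c}^*\in\overline{\mathcal{X}}$. For each $m\ge1$ define $$g_{m,\bm{\theta}}(\overline{\bm{x}}_n)=\int_{\overline{\mathcal{X}}}\int_{\overline{\mathcal{X}}}\ell(\widetilde{\bm{y}},\overline{\bm{y}})\,\mathrm{d}\widetilde{\mathbb{P}}_{\bm{\theta},m}(\widetilde{\bm{y}}\mid\overline{\bm{x}}_n)\,\mathrm{d}Q_m(\overline{\bm{y}}\mid\overline{\bm{x}}_n),\qquad \mathcal{J}_m^{\ell}(\bm{\theta})=\mathbb{E}_{\overline{\bm{x}}_n\sim\bar\mu}\big[g_{m,\bm{\theta}}(\overline{\bm{x}}_n)\big],$$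 and assume that for each fixed $\bm{\theta}$ the sequence $\{g_{m,\bm{\theta}}(\overline{\bm{x}}_n)\}_{m\ge1}$ is uniformly integrable under $\bar\mu$. Then $$\lim_{m\to\infty}\mathcal{J}_m^{\ell}(\bm{\theta})=\mathbb{E}_{\overline{\bm{x}}_n\sim\bar\mu}\left[\int_{\overline{\mathcal{X}}}R(\widetilde{\bm{y}})\,\mathrm{d}\widetilde{\mathbb{P}}_{\bm{\theta},\infty}(\widetilde{\bm{y}}\mid\overline{\bm{x}}_n)\right].$$ In particular, $\lim_{m\to\infty}\mathcal{J}_m^{\ell}(\bm{\theta})\ge R(\bm{c}^* )$, with equality if and only if $\widetilde{\mathbb{P}}_{\bm{\theta},\infty}(\cdot\mid\overline{\bm{x}}_n)=\delta_{\bm{c}^*}$ for $\bar\mu$-almost every $\overline{\bm{x}}_n$.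
   Context: $\bm{\Phi}$ is a measurable map on the full state space, and the coarse-graining map $\bm{x}\mapsto\overline{\bm{x}}$ is a measurable map from the full state space to the resolved space $\overline{\mathcal{X}}$. The true resolved process is $\overline{\bm{x}}_{n+m}=\overline{\bm{\Phi}^m(\bm{x}_n)}$. $\bm{F}_{\bm{\theta}}$ is a measurable map for each $\bm{\theta}$ in a parameter set. $\mathcal{P}_p(\overline{\mathcal{X}})$ is the space of Borel probability measures $\nu$ on $\overline{\mathcal{X}}$ with $\int d(x,x_0)^p\,\mathrm{d}\nu(x)<\infty$, and $W_p$ is the $p$-Wasserstein distance on it; the limits $\widetilde{\mathbb{P}}_{\bm{\theta},\infty}(\cdot\mid\overline{\bm{x}}_n)$ lie in $\mathcal{P}_p(\overline{\mathcal{X}})$. Conditional laws are regular conditional distributions. $\delta_{\bm{c}}$ is the Dirac measure at $\bm{c}$. *)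

(* Defs.v *)
From HB Require Import structures.
From mathcomp Require Import all_boot all_order all_algebra.
From mathcomp Require Import all_classical all_reals all_analysis.
From mathcomp Require Import giry.

Set Implicit Arguments.
Unset Strict Implicit.
Unset Printing Implicit Defensive.

Import Order.TTheory GRing.Theory Num.Theory.
Import numFieldNormedType.Exports.

Local Open Scope classical_set_scope.
Local Open Scope ring_scope.

(* [measurableType] requires a distinguished point, hence the pointed
   structure underlying [CompletePseudoMetric]; this point plays no role. *)
#[short(type="completeMetricType")]
HB.structure Definition CompleteMetric (K : numDomainType) :=
  { T of CompletePseudoMetric K T & Metric K T }.

Definition separable (T : topologicalType) : Prop :=
  exists2 D : set T, countable D & dense D.

Definition borel (T : ptopologicalType) := g_sigma_algebraType (@open T).

Section wasserstein.
Context {R : realType} (X : completeMetricType R).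
Implicit Types (p : R) (nu P Q : {measure set (borel X) -> \bar R}).

Definition dist_pow p (z : X * X) : \bar R := (mdist z.1 z.2 `^ p)%:E.

(* Membership in P_p(X). *)
Definition finite_moment_prob p (x0 : X) nu : Prop :=
  nu setT = 1%E /\ (\int[nu]_x dist_pow p (x, x0) < +oo)%E.

(* Couplings live on the product of the Borel sigma-algebras, which is the Borel
   sigma-algebra of X * X when X is separable. *)
Definition coupling P Q : set {measure set (borel X * borel X) -> \bar R} :=
  [set pi | forall A : set (borel X), measurable A ->
     pi (A `*` setT) = P A /\ pi (setT `*` A) = Q A].

Definition wasserstein p P Q : \bar R :=
  (ereal_inf [set \int[pi]_z dist_pow p z | pi in coupling P Q]
     `^ p^-1)%E.

Definition expected_loss (ell : X -> X -> R) P Q : R :=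
  \int[Q]_ybar (\int[P]_ytilde ell ytilde ybar).

Definition jointly_wasserstein_continuous p (x0 : X)
    (Psi : {measure set (borel X) -> \bar R} ->
           {measure set (borel X) -> \bar R} -> R) : Prop :=
  forall P Q, finite_moment_prob p x0 P -> finite_moment_prob p x0 Q ->
  forall e : R, 0 < e -> exists2 delta : R, 0 < delta &
  forall P' Q', finite_moment_prob p x0 P' -> finite_moment_prob p x0 Q' ->
    (wasserstein p P' P < delta%:E)%E -> (wasserstein p Q' Q < delta%:E)%E ->
    `|Psi P' Q' - Psi P Q| < e.

End wasserstein.

Section probability_notions.
Context d {T : measurableType d} {R : realType} (P : probability T R).

Definition mutually_independent (I : choiceType) (G : I -> set_system T) :
    Prop :=
  forall (J : seq I) (A : I -> set T), uniq J ->
    (forall i, i \in J -> G i (A i)) ->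
    P (\bigcap_(i in [set` J]) A i) = (\prod_(i <- J) P (A i))%E.

(* The probability kernel K is a regular version of the law of V given U. *)
Definition regular_cond_distribution d1 d2 (T1 : measurableType d1)
    (T2 : measurableType d2) (U : T -> T1) (V : T -> T2)
    (K : R.-pker T1 ~> T2) : Prop :=
  forall (B : set T1) (A : set T2), measurable B -> measurable A ->
    P (U @^-1` B `&` V @^-1` A) = (\int[P]_(w in U @^-1` B) K (U w) A)%E.

Definition uniformly_integrable (I : Type) (D : set I) (f : I -> T -> R) :
    Prop :=
  forall e : R, 0 < e -> exists M : R, forall i, D i ->
    (\int[P]_(x in [set y | (M < `|f i y|)%R]) `|f i x|%:E <= e%:E)%E.

End probability_notions.

Definition unique_minimizer (T : Type) (R : realType) (f : T -> R) (c : T) :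
    Prop :=
  (forall y, f c <= f y) /\ forall c', (forall y, f c' <= f y) -> c' = c.

(* The sigma-algebras generated by the initial state ([None]) and by each of
   the noise variables ([Some k]). *)
Definition state_noise_sigma d dS dE (Omega : measurableType d)
    (S : measurableType dS) (E : measurableType dE) (x : Omega -> S)
    (xi : nat -> Omega -> E) (i : option nat) : set_system Omega :=
  if i is Some k then g_sigma_algebra_preimage (xi k)
  else g_sigma_algebra_preimage x.

(* Main.v *)
Require Import Defs.
From HB Require Import structures.
From mathcomp Require Import all_boot all_order all_algebra.
From mathcomp Require Import all_classical all_reals all_analysis.
From mathcomp Require Import giry.
From mathcomp Require Import measurable_realfun lra.

(** Convergence in [W_p] to a measure with finite [p]-th moment forces finite
    [p]-th moments along the tail, by integrating the triangle inequality
    against a near-optimal coupling. Joint continuity of the expected loss thus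
    applies pointwise: [g m xn] converges, for almost every [xn], to the expected
    loss of [Pinf xn] against [mubar], which Fubini rewrites as the integral of
    the climatological risk against [Pinf xn]. Vitali's theorem passes to the
    limit under the expectation. The limit averages integrals of the risk
    against probability measures, hence is at least the minimum of the risk; in
    the equality case almost every [Pinf xn] gives mass zero to the set where
    the risk exceeds its minimum, i.e., to the complement of [cstar]. *)

Set Implicit Arguments.
Unset Strict Implicit.
Unset Printing Implicit Defensive.

Import Order.TTheory GRing.Theory Num.Theory.
Import numFieldNormedType.Exports.

Local Open Scope classical_set_scope.
Local Open Scope ring_scope.

(** * Borel measurability on a separable metric space *)

Lemma metric_ball_open (R : realType) (X : metricType R) (a : X) (r : R) :
  open (ball a r).
Proof.
rewrite openE => y; rewrite ballEmdist /= => yr.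
apply/nbhs_ballP; exists (r - mdist a y) => /=; first by rewrite subr_gt0.
move=> z; rewrite !ballEmdist /= ltrBrDl; exact/le_lt_trans/metric_triangle.
Qed.

Lemma separable_dense_sequence (T : ptopologicalType) :
  separable T ->
  exists s : nat -> T, forall O : set T, open O -> O !=set0 -> exists n, O (s n).
Proof.
move=> [D cD dD].
(* A countable set is empty or the image of a sequence; a dense subset of a pointed space cannot be
   empty. *)
have [D0|] := (elimT pfcard_geP cD).
  have [|x []] := dD setT _ openT; first by exists point.
  by rewrite D0.
case=> s; exists s => O oO O0.
have [x [Ox Dx]] := dD O O0 oO.
have [n _ snx] := @surj _ _ _ _ s x Dx.
by exists n; rewrite snx.
Qed.

Section measurability_of_continuous.
Context {R : realType} (X : completeMetricType R).
Hypothesis Xsep : separable X.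

(** An open set of [X * X] is a countable union of products of balls with centres in a dense
    sequence and radii [n.+1%:R^-1]. Separability thus puts it in the product of the Borel
    sigma-algebras, on which couplings live. *)
Lemma open_measurable_borel_prod (O : set (X * X)) :
  open O -> measurable (O : set (borel X * borel X)).
Proof.
move=> oO; have [s sP] := separable_dense_sequence Xsep.
pose box (t : nat * nat * nat) : set (X * X) :=
  ball (s t.1.1) t.2.+1%:R^-1 `*` ball (s t.1.2) t.2.+1%:R^-1.
(* With the inclusion inside the set, the union runs over the whole countable index type: [F t] is
   either [box t] or empty. *)
pose F (t : nat * nat * nat) : set (borel X * borel X) :=
  [set z | box t z /\ box t `<=` O].
have -> : O = \bigcup_t F t :> set (borel X * borel X).
  apply/seteqP; split=> [z Oz|z [t _ [tz]]]; last exact.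
  have [e /= e0 zeO] : nbhs_ball z O by apply/nbhs_ballP; exact: open_nbhs_nbhs.
  (* Radii below [e / 2] keep every point of a box containing [z] within [e] of [z]. *)
  have e20 : 0 < e / 2 by rewrite divr_gt0.
  have [n _ /(_ n (leqnn _))/= ne] := near_infty_natSinv_lt (PosNum e20).
  have n0 : 0 < n.+1%:R^-1 :> R by rewrite invr_gt0.
  have [i zi] : exists i, ball z.1 n.+1%:R^-1 (s i).
    by apply: sP; [exact: metric_ball_open|exists z.1; exact: ballxx].
  have [j zj] : exists j, ball z.2 n.+1%:R^-1 (s j).
    by apply: sP; [exact: metric_ball_open|exists z.2; exact: ballxx].
  exists (i, j, n) => //; split; first by split; exact: ball_sym.
  move=> w [/= wi wj]; apply: zeO; split.
  - apply: le_ball (ball_triangle zi wi).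
    by rewrite (splitr e) lerD// ltW.
  - apply: le_ball (ball_triangle zj wj).
    by rewrite (splitr e) lerD// ltW.
apply: countable_bigcupT_measurable; first exact: countableP.
move=> t; have [tO|tO] := pselect (box t `<=` O).
  have -> : F t = box t by apply/seteqP; split=> [z []|].
  by apply: measurableX; apply: sub_sigma_algebra; exact: metric_ball_open.
have -> : F t = set0 by apply/seteqP; split=> [z []|].
exact: measurable0.
Qed.

Lemma continuous_measurable_borel_prod (f : X * X -> R) :
  continuous f -> measurable_fun setT (f : borel X * borel X -> R).
Proof.
move=> cf; apply: (measurability _ (RGenOInfty.measurableE R)).
move=> /= _ [_ [a ->]] <-; rewrite setTI; apply: open_measurable_borel_prod.
by apply: open_comp => // z _; exact: cf.
Qed.

Lemma continuous_mdist : continuous (fun z : X * X => mdist z.1 z.2).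
Proof.
move=> z; apply/cvgrPdist_lt => e e0.
have e2 : 0 < e / 2 by rewrite divr_gt0.
near=> w.
have [h1 h2] : ball z (e / 2) w.
  near: w; exists (ball z.1 (e / 2), ball z.2 (e / 2)) => //=.
  by split; exact: nbhsx_ballx.
move: h1 h2; rewrite !ballEmdist/= => h1 h2.
have t1 := metric_triangle z.1 w.1 z.2; have t2 := metric_triangle w.1 w.2 z.2.
have t3 := metric_triangle w.1 z.1 w.2; have t4 := metric_triangle z.1 z.2 w.2.
rewrite (metric_sym w.1 z.1) (metric_sym w.2 z.2) in t2 t3.
by rewrite ltr_norml; apply/andP; split; lra.
Unshelve. all: by end_near. Qed.

Lemma measurable_dist_pow p :
  measurable_fun setT (dist_pow p : borel X * borel X -> \bar R).
Proof.
apply/measurable_EFinP.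
apply: (@measurableT_comp _ _ _ _ _ _ (fun r : R => r `^ p)).
  exact: measurable_powR.
exact: continuous_measurable_borel_prod continuous_mdist.
Qed.

Lemma measurable_pairl (y : borel X) :
  measurable_fun setT (fun x : borel X => (x, y)).
Proof. exact: measurable_fun_pair. Qed.

Lemma measurable_set1_borel (c : X) : measurable ([set c] : set (borel X)).
Proof.
rewrite -[X in measurable X]setCK; apply: measurableC.
apply: sub_sigma_algebra; rewrite openC.
exact/accessible_closed_set1/hausdorff_accessible/metric_hausdorff.
Qed.

End measurability_of_continuous.

(** * Transfer of finite moments along a finite Wasserstein distance *)

Lemma powRD_le (R : realType) (a b p : R) : 0 <= a -> 0 <= b -> 0 <= p ->
  (a + b) `^ p <= 2 `^ p * (a `^ p + b `^ p).
Proof.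
move=> a0 b0 p0; wlog ab : a b a0 b0 / a <= b.
  move=> wl; have [ab|/ltW ba] := leP a b; first exact: wl.
  by rewrite addrC [X in _ * X]addrC; exact: wl.
apply: (@le_trans _ _ ((2 * b) `^ p)).
  by apply: ge0_ler_powR; rewrite ?nnegrE//; lra.
rewrite powRM// ler_wpM2l ?powR_ge0//.
by rewrite lerDr powR_ge0.
Qed.

Section moment_transfer.
Context {R : realType} (X : completeMetricType R).
Hypothesis Xsep : separable X.
Local Open Scope ereal_scope.

Lemma measurable_dist_pow_point p (x0 : X) :
  measurable_fun setT (fun x : borel X => dist_pow p (x, x0)).
Proof.
apply: (@measurableT_comp _ _ _ _ _ _ (dist_pow p : borel X * borel X -> _)).
  exact: measurable_dist_pow.
exact: measurable_pairl.
Qed.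

Lemma dist_pow_ge0 p (z : X * X) : 0 <= dist_pow p z.
Proof. by rewrite lee_fin powR_ge0. Qed.

(** Change of variables: the first projection pushes [pi] forward to [mu]. *)
Lemma integral_marginal1 (mu : {measure set (borel X) -> \bar R})
    (pi : {measure set (borel X * borel X) -> \bar R}) (f : borel X -> \bar R) :
  (forall A, measurable A -> pi (A `*` setT) = mu A) ->
  measurable_fun setT f -> (forall x, 0 <= f x) ->
  \int[mu]_x f x = \int[pi]_z f z.1.
Proof.
move=> pimu mf f0.
rewrite -(ge0_integral_pushforward measurable_fst pi measurableT mf)//.
apply: eq_measure_integral => A mA _; rewrite -pimu// /pushforward.
by congr (pi _); apply/seteqP; split=> [z []|].
Qed.

Lemma integral_marginal2 (mu : {measure set (borel X) -> \bar R})
    (pi : {measure set (borel X * borel X) -> \bar R}) (f : borel X -> \bar R) :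
  (forall A, measurable A -> pi (setT `*` A) = mu A) ->
  measurable_fun setT f -> (forall x, 0 <= f x) ->
  \int[mu]_x f x = \int[pi]_z f z.2.
Proof.
move=> pimu mf f0.
rewrite -(ge0_integral_pushforward measurable_snd pi measurableT mf)//.
apply: eq_measure_integral => A mA _; rewrite -pimu// /pushforward.
by congr (pi _); apply/seteqP; split=> [z []|].
Qed.

Lemma finite_moment_wasserstein p (x0 : X)
    (P Q : {measure set (borel X) -> \bar R}) : (1 <= p)%R ->
  finite_moment_prob p x0 P -> Q setT = 1 -> wasserstein p Q P < +oo ->
  finite_moment_prob p x0 Q.
Proof.
move=> p1 [_ Pfin] Q1 QP; split => //.
have p0 : (0 < p)%R by rewrite (lt_le_trans _ p1).
(* With exponent zero, [+oo] would have power 1, and finiteness of the distance would not bound the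
   infimum of the costs. *)
have pV0 : (p^-1 != 0)%R by rewrite invr_eq0 lt0r_neq0.
have /ereal_inf_lt[_ [pi piQP <-] pifin] := lty_poweRy pV0 QP.
have mx0 := measurable_dist_pow_point p x0.
have d0 x : 0 <= dist_pow p (x, x0) by exact: dist_pow_ge0.
rewrite (integral_marginal1 (fun A mA => proj1 (piQP A mA)) mx0 d0).
rewrite (integral_marginal2 (fun A mA => proj2 (piQP A mA)) mx0 d0) in Pfin.
have m1 := measurable_dist_pow Xsep p.
have m2 : measurable_fun setT
    (fun z : borel X * borel X => dist_pow p (z.2, x0)).
  exact: (measurableT_comp mx0).
(* Under the finite-cost coupling [pi], the moment of [Q] is that of the first coordinate; the
   triangle inequality through the second coordinate bounds it by the cost plus the moment of
   [P]. *)
apply: (@le_lt_trans _ _ (\int[pi]_z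
    ((2 `^ p)%:E * (dist_pow p z + dist_pow p (z.2, x0))))).
  apply: ge0_le_integral => //=.
  - exact: (measurableT_comp mx0).
  - by apply: measurable_funeM; exact: emeasurable_funD.
  move=> z _; rewrite -EFinD -EFinM lee_fin.
  apply: le_trans (powRD_le _ _ _); rewrite ?mdist_ge0// ?(ltW p0)//.
  apply: ge0_ler_powR; rewrite ?nnegrE ?addr_ge0 ?mdist_ge0// ?(ltW p0)//.
  exact: metric_triangle.
rewrite ge0_integralZl_EFin ?powR_ge0//; last 2 first.
- by move=> z _; rewrite adde_ge0 ?dist_pow_ge0.
- exact: emeasurable_funD.
rewrite ge0_integralD//; last by move=> z _; exact: dist_pow_ge0.
by rewrite lte_mul_pinfty ?lee_fin ?powR_ge0// lte_add_pinfty.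
Qed.

End moment_transfer.

(** * Integrals of arbitrary functions and null sets *)

Section null_sets.
Context d (T : measurableType d) (R : realType).
Variable mu : {measure set T -> \bar R}.
Local Open Scope ereal_scope.

Import HBNNSimple.

(** Both sides are suprema over simple functions. A simple function below [f], multiplied by the
    indicator of the complement of [N], lies below the restriction and has the same integral. *)
Lemma ge0_integral_restrict_conull (N : set T) (f : T -> \bar R) :
  measurable N -> mu N = 0 -> (forall x, 0 <= f x) ->
  \int[mu]_x (f \_ (~` N)) x = \int[mu]_x f x.
Proof.
move=> mN N0 f0; rewrite !ge0_integralTE//; last first.
  by move=> x; rewrite patchE; case: ifP.
apply/eqP; rewrite eq_le; apply/andP; split.
  apply: le_ereal_sup => _ [h hf <-]; exists h => // x.
  apply: (le_trans (hf x)); rewrite patchE.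
  by case: ifP => // _; exact: f0.
apply: ge_ereal_sup => _ [h hf <-].
rewrite -integralT_nnsfun.
have mh : measurable_fun setT (fun x => (h x)%:E) by exact/measurable_EFinP.
pose h' := mul_nnsfun h (indic_nnsfun R (measurableC mN)).
suff -> : \int[mu]_x (h x)%:E = \int[mu]_x (h' x)%:E.
  rewrite integralT_nnsfun; apply: ereal_sup_ubound; exists h' => // x /=.
  rewrite patchE /mindic indicE; case: ifPn => _; first by rewrite mulr1.
  by rewrite mulr0.
apply: ae_eq_integral => //; first exact/measurable_EFinP.
exists N; split=> // x /= /not_implyP[_]; apply: contra_notP => xN.
by rewrite /= /mindic indicE mem_set//= mulr1.
Qed.

(* No measurability of [f] is assumed: the integral of the library is defined,
   by suprema over simple functions, for every function. *)
Lemma integral_restrict_conull (N : set T) (f : T -> \bar R) :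
  measurable N -> mu N = 0 ->
  \int[mu]_x (f \_ (~` N)) x = \int[mu]_x f x.
Proof.
move=> mN N0; rewrite integralE [RHS]integralE funepos_restrict funeneg_restrict.
by congr (_ - _); exact: ge0_integral_restrict_conull.
Qed.

Lemma eq_integral_conull (N : set T) (f g : T -> \bar R) :
  measurable N -> mu N = 0 -> (forall x, ~ N x -> f x = g x) ->
  \int[mu]_x f x = \int[mu]_x g x.
Proof.
move=> mN N0 fg; rewrite -(integral_restrict_conull f mN N0).
rewrite -[RHS](integral_restrict_conull g mN N0); apply: eq_integral => x _.
by rewrite !patchE; case: ifPn => // /[1!inE]; exact: fg.
Qed.

End null_sets.

(** * Measurability of integrals against kernels *)

Section pullback_kernel.
Context d1 d2 d3 (T1 : measurableType d1) (T2 : measurableType d2)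
  (T3 : measurableType d3) (R : realType).
Local Open Scope ereal_scope.

(** Carrying the second coordinate as an inert parameter lets a kernel from [T1] integrate functions
    that also depend on a point of [T2]. *)
Definition pullback_fst (l : R.-pker T1 ~> T3) :
  T1 * T2 -> {measure set T3 -> \bar R} := fun z => l z.1.

Variable l : R.-pker T1 ~> T3.

Let measurable_pullback_fst (U : set T3) :
  measurable U -> measurable_fun setT (pullback_fst l ^~ U).
Proof.
by move=> mU; exact: (measurableT_comp (measurable_kernel l U mU)).
Qed.

HB.instance Definition _ :=
  isKernel.Build _ _ _ _ R (pullback_fst l) measurable_pullback_fst.

Let pullback_fst_prob z : pullback_fst l z setT = 1.
Proof. exact: prob_kernel. Qed.

HB.instance Definition _ :=
  Kernel_isProbability.Build _ _ _ _ R (pullback_fst l) pullback_fst_prob.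

End pullback_kernel.

Section measurable_Rintegral_kernel.
Context d1 d2 d3 (T1 : measurableType d1) (T2 : measurableType d2)
  (T3 : measurableType d3) (R : realType).

(** The positive and negative parts have measurable integrals by the nonnegative case. Extended
    subtraction and [fine] preserve measurability even where these are infinite, so [k] may fail to
    be integrable. *)
Lemma measurable_Rintegral_kernel (l : R.-pker T1 ~> T2) (k : T1 * T2 -> R) :
  measurable_fun setT k ->
  measurable_fun setT (fun x => \int[l x]_y k (x, y)).
Proof.
move=> mk; have mk' : measurable_fun setT (EFin \o k) by exact/measurable_EFinP.
apply: (@measurableT_comp _ _ _ _ _ _ fine); first exact: fine_measurable.
under eq_fun do rewrite integralE.
apply: emeasurable_funB.
- rewrite [X in measurable_fun _ X](_ : _ =
      fun x => (\int[l x]_y (EFin \o k)^\+ (x, y))%E).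
    apply: (measurable_fun_integral_finite_kernel _ l) => //.
    exact: measurable_funepos.
  by apply/funext => x; apply: eq_integral => y _; rewrite !funeposE.
- rewrite [X in measurable_fun _ X](_ : _ =
      fun x => (\int[l x]_y (EFin \o k)^\- (x, y))%E).
    apply: (measurable_fun_integral_finite_kernel _ l) => //.
    exact: measurable_funeneg.
  by apply/funext => x; apply: eq_integral => y _; rewrite !funenegE.
Qed.

End measurable_Rintegral_kernel.

Section measurable_Rintegral_pullback.
Context d1 d2 d3 (T1 : measurableType d1) (T2 : measurableType d2)
  (T3 : measurableType d3) (R : realType).

Lemma measurable_Rintegral_pullback_fst (l : R.-pker T1 ~> T3)
    (k : (T1 * T2) * T3 -> R) :
  measurable_fun setT k ->
  measurable_fun setT (fun z : T1 * T2 => \int[l z.1]_y k (z, y)).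
Proof.
exact: (measurable_Rintegral_kernel (pullback_fst l)).
Qed.

End measurable_Rintegral_pullback.

(** * Vitali's convergence theorem *)

Section vitali.
Context d (T : measurableType d) (R : realType) (P : probability T R).

(** For [0 <= M] this truncates to the interval from [- M] to [M]. Unlike a cut-off by an indicator
    it is continuous in [x], hence commutes with pointwise limits. *)
Definition clamp (M x : R) : R :=
  if M <= x then M else if x <= - M then - M else x.

Lemma clamp_bound M x : 0 <= M -> `|clamp M x| <= M.
Proof.
move=> M0; rewrite /clamp; case: (leP M x) => Mx; first by rewrite ger0_norm.
case: (leP x (- M)) => xM; first by rewrite normrN ger0_norm.
by rewrite ler_norml !ltW.
Qed.

Lemma clamp_id M x : `|x| <= M -> clamp M x = x.
Proof.
rewrite ler_norml => /andP[Nx xM]; rewrite /clamp; case: (leP M x) => [Mx|_].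
  by apply/eqP; rewrite eq_le Mx xM.
by case: (leP x (- M)) => // xN; apply/eqP; rewrite eq_le Nx xN.
Qed.

Lemma dist_clamp_le M x : 0 <= M -> `|x - clamp M x| <= `|x|.
Proof.
move=> M0; rewrite /clamp; case: (leP M x) => Mx.
  by rewrite !ger0_norm; lra.
case: (leP x (- M)) => xM; last by rewrite subrr normr0.
by rewrite !ler0_norm; lra.
Qed.

Lemma clamp_lipschitz M x y : 0 <= M -> `|clamp M x - clamp M y| <= `|x - y|.
Proof.
move=> M0; wlog xy : x y / x <= y.
  move=> wl; have [xy|/ltW yx] := leP x y; first exact: wl.
  by rewrite distrC (distrC x); exact: wl.
rewrite distrC (distrC x) [leRHS]ger0_norm ?subr_ge0//.
rewrite ler_norml /clamp; apply/andP.
by case: (leP M x) => Mx; case: (leP M y) => My;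
  [|case: (leP y (- M)) => Ny|case: (leP x (- M)) => Nx|
   case: (leP x (- M)) => Nx; case: (leP y (- M)) => Ny]; split; lra.
Qed.

Lemma continuous_clamp M : 0 <= M -> continuous (clamp M).
Proof.
move=> M0 x; apply/cvgrPdist_lt => e e0; near=> y.
apply: (le_lt_trans (clamp_lipschitz x y M0)).
near: y; exact: cvgr_dist_lt.
Unshelve. all: by end_near. Qed.

Lemma measurable_clamp M (f : T -> R) : 0 <= M ->
  measurable_fun setT f -> measurable_fun setT (clamp M \o f).
Proof.
move=> M0; apply: measurableT_comp; apply: continuous_measurable_fun.
exact: continuous_clamp.
Qed.

Lemma integrable_clamp M (f : T -> R) : 0 <= M ->
  measurable_fun setT f -> P.-integrable setT (EFin \o (clamp M \o f)).
Proof.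
move=> M0 mf.
apply: (@le_integrable _ _ _ _ _ measurableT _ (EFin \o cst M)).
- by apply/measurable_EFinP; exact: measurable_clamp.
- move=> x _ /=; rewrite lee_fin (ger0_norm M0); exact: clamp_bound.
- exact: finite_measure_integrable_cst.
Qed.

(** The truncation error vanishes where [g i] is at most the level in absolute value and is at most
    [|g i|] elsewhere, so the tail integral dominates it. *)
Lemma uniformly_integrable_clamp (J : Type) (g : J -> T -> R) :
  (forall i, measurable_fun setT (g i)) -> uniformly_integrable P setT g ->
  forall e, 0 < e -> exists2 M, 0 <= M & forall i,
    (\int[P]_x `|g i x - clamp M (g i x)|%:E <= e%:E)%E.
Proof.
move=> mg ui e e0; have [M gM] := ui e e0.
(* Uniform integrability may supply a negative threshold, while truncation needs a nonnegative
   level. *)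
have M0 : 0 <= Num.max 0 M by rewrite le_max lexx.
exists (Num.max 0 M) => //.
move=> i; apply: le_trans (gM i I); rewrite [leRHS]integral_mkcond.
apply: ge0_le_integral => //=.
- apply/measurable_EFinP; apply: measurableT_comp => //.
  by apply: measurable_funB => //; exact: measurable_clamp.
- have mD : measurable [set y | M < `|g i y|].
    have mn : measurable_fun setT (fun y => `|g i y|).
      exact: measurableT_comp.
    have := mn measurableT _ (measurable_itv `]M, +oo[); rewrite setTI.
    by congr measurable; apply/seteqP; split=> y /=; rewrite in_itv/= andbT.
  apply/(measurable_restrictT _ mD).1/measurable_funTS/measurable_EFinP.
  exact: measurableT_comp.
- move=> x _; rewrite patchE; case: ifPn => [_|].
  by rewrite lee_fin dist_clamp_le.
  rewrite notin_setE/= => /negP; rewrite -leNgt => gx.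
  by rewrite clamp_id ?subrr ?normr0// le_max gx orbT.
Qed.

Lemma vitali_cvg_everywhere (g : nat -> T -> R) (f : T -> R) :
  (forall m, measurable_fun setT (g m)) ->
  uniformly_integrable P setT g ->
  (forall x, g m x @[m --> \oo] --> f x) ->
  P.-integrable setT (EFin \o f) /\
  (\int[P]_x (g m x)%:E @[m --> \oo] --> \int[P]_x (f x)%:E)%E.
Proof.
move=> mg ui gf.
have mf : measurable_fun setT f.
  by apply: (measurable_fun_cvg mg) => x _; exact: gf.
have tail := uniformly_integrable_clamp mg ui.
(* A bound on the truncation errors that is uniform in [m] passes to [f] by Fatou's lemma, as these
   errors converge pointwise. *)
have tailf M e : 0 <= M ->
    (forall m, (\int[P]_x `|g m x - clamp M (g m x)|%:E <= e%:E)%E) ->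
    (\int[P]_x `|f x - clamp M (f x)|%:E <= e%:E)%E.
  move=> M0 he.
  pose u m x := `|g m x - clamp M (g m x)|%:E.
  have mu m : measurable_fun setT (u m).
    apply/measurable_EFinP; apply: measurableT_comp => //.
    by apply: measurable_funB => //; exact: measurable_clamp.
  have u0 m x : setT x -> (0 <= u m x)%E by move=> _; rewrite /u lee_fin.
  have -> : (\int[P]_x `|f x - clamp M (f x)|%:E =
             \int[P]_x limn_einf (u ^~ x))%E.
    apply: eq_integral => x _.
    suff /cvg_limn_einf_sup[-> _] : (u m x @[m --> \oo] -->
        `|f x - clamp M (f x)|%:E)%E by [].
    apply: cvg_EFin; first by near=> m.
    apply: cvg_norm; apply: cvgB; first exact: gf.
    by apply: continuous_cvg; [exact: continuous_clamp|exact: gf].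
  apply: le_trans (fatou P measurableT mu u0) _.
  rewrite limn_einf_lim; apply: lime_le; first exact: is_cvg_einfs.
  near=> m; apply: le_trans (he m).
  by apply: ereal_inf_lbound; exists m => /=.
(* A function is its truncation error, of finite integral here, plus its bounded truncation. *)
have intc (h : T -> R) M (e : R) : measurable_fun setT h -> 0 <= M ->
    (\int[P]_x `|h x - clamp M (h x)|%:E <= e%:E)%E ->
    P.-integrable setT (EFin \o (h \- (clamp M \o h))) /\
    P.-integrable setT (EFin \o h).
  move=> mh M0 he.
  have i1 : P.-integrable setT (EFin \o (h \- (clamp M \o h))).
    apply/integrableP; split.
      by apply/measurable_EFinP/measurable_funB => //; exact: measurable_clamp.
    exact: le_lt_trans he (ltry _).
  split => //.
  have := integrableD measurableT i1 (integrable_clamp M0 mh).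
  by apply: eq_integrable => // x _ /=; rewrite -EFinD subrK.
have tailR (h : T -> R) M (e : R) : measurable_fun setT h -> 0 <= M ->
    (\int[P]_x `|h x - clamp M (h x)|%:E <= e%:E)%E ->
    `|\int[P]_x h x - \int[P]_x (clamp M (h x))| <= e.
  move=> mh M0 he; have [i1 i2] := intc h M e mh M0 he.
  rewrite -RintegralB//; last exact: integrable_clamp.
  apply: le_trans (le_normr_Rintegral measurableT i1) _.
  rewrite -lee_fin fineK//; apply: integrable_fin_num => //.
  exact: integrable_norm.
have [M0 M00 gM0] := tail 1 ltr01.
have intf : P.-integrable setT (EFin \o f).
  by have [] := intc f M0 1 mf M00 (tailf _ _ M00 gM0).
have intg m : P.-integrable setT (EFin \o g m).
  by have [] := intc (g m) M0 1 (mg m) M00 (gM0 m).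
split => //.
rewrite -[X in _ --> X]fineK; last exact: integrable_fin_num intf.
apply: cvg_EFin.
  by near=> m; exact: integrable_fin_num (intg m).
apply/cvgrPdist_lt => e e0.
(* One third each for truncating [g m], for truncating [f], and for the convergence of the truncated
   integrals, which is dominated by the constant [M]. *)
have e3 : 0 < e / 3 by rewrite divr_gt0.
have [M M0' gM] := tail _ e3.
have : (\int[P]_x (clamp M (g m x))%:E @[m --> \oo] -->
        (\int[P]_x clamp M (f x))%:E)%E.
  rewrite /Rintegral fineK; last exact: (integrable_fin_num _ (integrable_clamp M0' mf)).
  apply: (@dominated_cvg _ _ _ _ _ measurableT _ _ (EFin \o cst M)) => //.
  - by move=> m; apply/measurable_EFinP; exact: measurable_clamp.
  - move=> x _; apply: cvg_EFin; first by near=> m.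
    by apply: continuous_cvg; [exact: continuous_clamp|exact: gf].
  - exact: finite_measure_integrable_cst.
  - by move=> m x _ /=; rewrite lee_fin clamp_bound.
move/fine_cvg/cvgrPdist_lt => /(_ _ e3) close.
near=> m.
have hg := tailR _ _ _ (mg m) M0' (gM m).
have hf := tailR _ _ _ mf M0' (tailf _ _ M0' gM).
have hc : `|\int[P]_x clamp M (f x) - \int[P]_x clamp M (g m x)| < e / 3.
  by near: m.
rewrite -[fine _]/(\int[P]_x f x) -[(fine \o _) m]/(\int[P]_x g m x).
move: hg hf hc; rewrite !ler_norml !ltr_norml => /andP[? ?] /andP[? ?] /andP[? ?].
by apply/andP; split; lra.
Unshelve. all: by end_near. Qed.

(* The limit [f] need not be measurable; the measurable function [f'] is a
   version of it. *)
Lemma vitali_cvg (g : nat -> T -> R) (f : T -> R) :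
  (forall m, measurable_fun setT (g m)) ->
  uniformly_integrable P setT g ->
  {ae P, forall x, g m x @[m --> \oo] --> f x} ->
  exists f' : T -> R, [/\ P.-integrable setT (EFin \o f'),
    {ae P, forall x, f x = f' x} &
    (\int[P]_x (g m x)%:E @[m --> \oo] --> \int[P]_x (f' x)%:E)%E].
Proof.
move=> mg ui [N [mN N0 subN]].
have cvgN x : ~ N x -> g m x @[m --> \oo] --> f x.
  by move=> Nx; apply: contrapT => h; apply: Nx; exact: subN.
(* Setting everything to zero on [N] makes the convergence hold at every point. *)
pose f' := f \_ (~` N); pose g' m := g m \_ (~` N).
(* The tail sets of [g' m] and [g m] may differ on [N], so the domains are moved into the integrands
   before comparing off [N]. *)
have g'E m (D : set R) : (\int[P]_(x in [set y | D (g' m y)]) `|g' m x|%:E =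
    \int[P]_(x in [set y | D (g m y)]) `|g m x|%:E)%E.
  rewrite integral_mkcond [RHS]integral_mkcond.
  apply: (eq_integral_conull mN N0) => x Nx; rewrite !patchE.
  have -> : g' m x = g m x by rewrite /g' patchE mem_set.
  rewrite /=; do 2 case: ifPn => //; rewrite !(inE, notin_setE)/=.
    by rewrite /g' patchE mem_set.
  by rewrite /g' patchE mem_set.
have [| | |intf' cv] := @vitali_cvg_everywhere g' f'.
- move=> m; apply/(measurable_restrictT _ _).1 => //; first exact: measurableC.
  exact: measurable_funTS.
- move=> e e0; have [M gM] := ui e e0; exists M => m _.
  by rewrite (g'E m (fun r => M < `|r|)); exact: gM.
- move=> x; rewrite /f' /g' !patchE; case: ifPn => [|xN].
    by rewrite inE => Nx; under eq_fun do rewrite patchE mem_set//; exact: cvgN.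
  by under eq_fun do rewrite patchE (negbTE xN); exact: cvg_cst.
exists f'; split => //.
  exists N; split => // x /=; apply: contra_notP => Nx.
  by rewrite /f' patchE mem_set.
suff -> : (fun m => \int[P]_x (g m x)%:E)%E = (fun m => \int[P]_x (g' m x)%:E)%E.
  by [].
apply/funext => m; apply: (eq_integral_conull mN N0) => x Nx.
by rewrite /g' patchE mem_set.
Unshelve. all: by end_near. Qed.

End vitali.

(** * Integrability of the loss and the climatological risk *)

Section expected_loss.
Context {R : realType} (X : completeMetricType R).
Hypothesis Xsep : separable X.
Variables (x0 : X) (p : R).
Variable ell : X -> X -> R.
Hypothesis ell_cont : continuous (fun z : X * X => ell z.1 z.2).
Variable C : R.
Hypothesis C_gt0 : 0 < C.
Hypothesis ell_growth : forall yt yb,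
  `|ell yt yb| <= C * (1 + mdist yt x0 `^ p + mdist yb x0 `^ p).

Lemma measurable_loss :
  measurable_fun setT (fun z : borel X * borel X => ell z.1 z.2).
Proof. exact: continuous_measurable_borel_prod. Qed.

Lemma measurable_lossl c : measurable_fun setT (fun y : borel X => ell c y).
Proof.
apply: (@measurableT_comp _ _ _ _ _ _
  (fun z : borel X * borel X => ell z.1 z.2) _
  (fun y : borel X => (c : borel X, y)) measurable_loss).
exact: measurable_fun_pair.
Qed.

Lemma measurable_lossr c : measurable_fun setT (fun x : borel X => ell x c).
Proof.
apply: (@measurableT_comp _ _ _ _ _ _
  (fun z : borel X * borel X => ell z.1 z.2) _
  (fun x : borel X => (x, c : borel X)) measurable_loss).
exact: measurable_pairl.
Qed.

Lemma integrable_dist_pow (P : {measure set (borel X) -> \bar R}) :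
  finite_moment_prob p x0 P ->
  P.-integrable setT (fun x => dist_pow p (x, x0)).
Proof.
move=> [_ Pp]; apply/integrableP; split; first exact: measurable_dist_pow_point.
under eq_integral do rewrite gee0_abs ?dist_pow_ge0//.
exact: Pp.
Qed.

Section two_measures.
Variables P Q : probability (borel X) R.
Hypothesis Pp : finite_moment_prob p x0 P.
Hypothesis Qp : finite_moment_prob p x0 Q.
Local Open Scope ereal_scope.

Lemma integrable_loss_point c : Q.-integrable setT (fun y => (ell c y)%:E).
Proof.
apply: (@le_integrable _ _ _ Q _ measurableT _ (fun y =>
    (C * (1 + mdist c x0 `^ p))%:E + C%:E * dist_pow p (y, x0))).
- by apply/measurable_EFinP; exact: measurable_lossl.
- move=> y _ /=; rewrite lee_fin; apply: (le_trans (ell_growth _ _)).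
  by rewrite -mulrDr ger0_norm// mulr_ge0 ?(ltW C_gt0)// !addr_ge0 ?powR_ge0.
- apply: integrableD => //; first exact: finite_measure_integrable_cst.
  by apply: integrableZl => //; exact: integrable_dist_pow.
Qed.

Lemma integrable_loss_pointr c : Q.-integrable setT (fun x => (ell x c)%:E).
Proof.
apply: (@le_integrable _ _ _ Q _ measurableT _ (fun y =>
    (C * (1 + mdist c x0 `^ p))%:E + C%:E * dist_pow p (y, x0))).
- by apply/measurable_EFinP; exact: measurable_lossr.
- move=> y _ /=; rewrite lee_fin; apply: (le_trans (ell_growth _ _)).
  by rewrite addrAC -mulrDr ger0_norm// mulr_ge0 ?(ltW C_gt0)// !addr_ge0 ?powR_ge0.
- apply: integrableD => //; first exact: finite_measure_integrable_cst.
  by apply: integrableZl => //; exact: integrable_dist_pow.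
Qed.

(** The growth bound is a sum of terms in at most one coordinate; the other coordinate integrates to
    1, which leaves the moments of [P] and [Q]. *)
Lemma integrable_loss_prod :
  (P \x Q).-integrable setT (fun z => (ell z.1 z.2)%:E).
Proof.
have md := measurable_dist_pow_point Xsep p x0.
apply: (@le_integrable _ _ _ (P \x Q) _ measurableT _ (fun z => C%:E +
    (C%:E * dist_pow p (z.1, x0) + C%:E * dist_pow p (z.2, x0)))).
- by apply/measurable_EFinP; exact: measurable_loss.
- move=> y _ /=; rewrite lee_fin; apply: (le_trans (ell_growth _ _)).
  rewrite !mulrDr mulr1 addrA ger0_norm//.
  by rewrite !addr_ge0 ?mulr_ge0 ?powR_ge0 ?(ltW C_gt0).
- apply: integrableD => //.
    apply/integrable12ltyP; first exact: measurable_cst.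
    under eq_integral.
      move=> x _ /=; rewrite integral_cst//.
      rewrite [X in _ * X](@probability_setT _ _ _ Q) mule1; over.
    by rewrite integral_cst// [X in _ * X](@probability_setT _ _ _ P) mule1 ltry.
  apply: integrableD => //; apply: integrableZl => //.
  + apply/integrable12ltyP; first exact: (measurableT_comp md).
    under eq_integral.
      move=> x _ /=; rewrite integral_cst//.
      rewrite [X in _ * X](@probability_setT _ _ _ Q) mule1; over.
    by have /integrableP[] := integrable_dist_pow Pp.
  + apply/integrable21ltyP; first exact: (measurableT_comp md).
    under eq_integral.
      move=> x _ /=; rewrite integral_cst//.
      rewrite [X in _ * X](@probability_setT _ _ _ P) mule1; over.
    by have /integrableP[] := integrable_dist_pow Qp.
Qed.

Lemma EFin_risk c : (\int[Q]_y ell c y)%:E = \int[Q]_y (ell c y)%:E.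
Proof. by rewrite fineK// integrable_fin_num//; exact: integrable_loss_point. Qed.

Lemma integrable_risk :
  P.-integrable setT (fun c => (\int[Q]_y ell c y)%:E).
Proof.
under [X in _.-integrable _ X]eq_fun do rewrite EFin_risk.
exact: (integrable_fubini_F integrable_loss_prod).
Qed.

End two_measures.

Lemma expected_loss_risk (P Q : probability (borel X) R) :
  finite_moment_prob p x0 P -> finite_moment_prob p x0 Q ->
  expected_loss ell P Q = \int[P]_c (\int[Q]_y ell c y).
Proof.
move=> Pp Qp; rewrite /expected_loss.
have ell_int := integrable_loss_prod Pp Qp.
(* The inner real integral hides a [fine], harmless because each section of [ell] is integrable. *)
transitivity (fine (\int[Q]_y \int[P]_x (ell x y)%:E)%E).
  congr fine; apply: eq_integral => y _; rewrite fineK//.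
  apply: integrable_fin_num => //; exact: integrable_loss_pointr.
congr fine; rewrite -(Fubini ell_int).
by apply: eq_integral => c _; rewrite EFin_risk.
Qed.

End expected_loss.

(** * Lower bounds of means and the equality case *)

Section lower_bound.
Context d (T : measurableType d) (R : realType) (P : probability T R).

Lemma Rintegral_ge_cst (f : T -> R) a : P.-integrable setT (EFin \o f) ->
  {ae P, forall x, a <= f x} -> a <= \int[P]_x f x.
Proof.
move=> intf af; have -> : a = \int[P]_x a.
  by rewrite Rintegral_cst// [X in fine X](@probability_setT _ _ _ P) mulr1.
rewrite -subr_ge0 -RintegralB//; last exact: finite_measure_integrable_cst.
have intfa : P.-integrable setT (fun x => (f x)%:E - a%:E)%E.
  by apply: integrableB => //; exact: finite_measure_integrable_cst.
rewrite /Rintegral (ae_eq_integral (fun x => `|f x - a|%:E)%E)//.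
- by apply: fine_ge0; apply: integral_ge0 => x _; rewrite lee_fin.
- by have /integrableP[] := intfa.
- by have /integrableP[] := integrable_abse intfa.
- by apply: filterS af => x afx _; rewrite ger0_norm// subr_ge0.
Qed.

(** The difference [f - a] agrees almost everywhere with its absolute value, whose integral is then
    zero. *)
Lemma Rintegral_eq_lower_bound (f : T -> R) a :
  P.-integrable setT (EFin \o f) -> {ae P, forall x, a <= f x} ->
  \int[P]_x f x = a -> {ae P, forall x, f x = a}.
Proof.
move=> intf af fa.
have intfa : P.-integrable setT (fun x => (f x)%:E - a%:E)%E.
  by apply: integrableB => //; exact: finite_measure_integrable_cst.
have /integrableP[mfa _] := intfa.
suff /(ae_eq_integral_abs P measurableT mfa) : (\int[P]_x `|(f x)%:E - a%:E| = 0)%E.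
  by apply: filterS => x /(_ I)[] /eqP; rewrite subr_eq0 => /eqP.
rewrite (ae_eq_integral (fun x => (f x)%:E - a%:E)%E)//.
- rewrite integralB//; last exact: finite_measure_integrable_cst.
  rewrite integral_cst// [X in (_ * X)%E](@probability_setT _ _ _ P) mule1.
  rewrite -[X in (X - _)%E]fineK; last exact: integrable_fin_num intf.
  by rewrite -[fine _]/(\int[P]_x f x) fa -EFinB subrr.
- exact: measurableT_comp.
- by apply: filterS af => x afx _; rewrite gee0_abs// lee_fin subr_ge0.
Qed.

End lower_bound.

Section minimizer.
Context {R : realType} (X : completeMetricType R).
Variables (P : probability (borel X) R) (r : X -> R) (c : X).
Hypothesis r_int : P.-integrable setT (EFin \o (r : borel X -> R)).
Hypothesis r_min : unique_minimizer r c.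

Lemma Rintegral_ge_minimum : r c <= \int[P]_x r x.
Proof.
by apply: Rintegral_ge_cst => //; apply: aeW => x; have [] := r_min.
Qed.

Lemma Rintegral_eq_minimum :
  \int[P]_x r x = r c <-> measure_eq P \d_(c : borel X).
Proof.
split=> [rc A mA|Pc]; last first.
  rewrite /Rintegral (eq_measure_integral \d_(c : borel X)); last first.
    by move=> A mA _; exact: Pc.
  rewrite integral_dirac ?diracT ?mul1e//.
  by have /integrableP[] := r_int.
have [N [mN N0 subN]] := Rintegral_eq_lower_bound r_int
  (aeW _ (fun x : borel X => proj1 r_min x)) rc.
(* A point where [r] takes the value [r c] is itself a global minimizer, hence equals [c] by
   uniqueness. *)
have PcC : P (~` [set c]) = 0%E.
  apply: (subset_measure0 _ mN _ N0).
    by apply: measurableC; exact: measurable_set1_borel.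
  move=> x /= xc; apply: subN => /= rxc; apply: xc.
  by apply: (proj2 r_min) => y; rewrite rxc; exact: (proj1 r_min).
have P0 (B : set (borel X)) : measurable B -> B `<=` ~` [set c] -> P B = 0%E.
  move=> mB Bc; apply: (subset_measure0 mB _ Bc PcC).
  by apply: measurableC; exact: measurable_set1_borel.
rewrite /= diracE; have [cA|cA] := pselect (A c).
  rewrite mem_set//.
  have := probability_setC P (measurableC mA); rewrite setCK => ->.
  rewrite P0 ?sube0//; first exact: measurableC.
  by move=> x /= xA xc; apply: xA; rewrite xc.
by rewrite memNset//= P0// => x Ax xc; apply: cA; rewrite -xc.
Qed.

End minimizer.

(** * Measurability and convergence of the expected loss, and the limit theorem *)

Lemma measurable_expected_loss (R : realType) (X : completeMetricType R)
    (ell : X -> X -> R) (P Q : R.-pker (borel X) ~> (borel X)) :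
  measurable_fun setT (fun z : borel X * borel X => ell z.1 z.2) ->
  measurable_fun setT (fun x : borel X => expected_loss ell (P x) (Q x)).
Proof.
move=> mell.
apply: (measurable_Rintegral_kernel Q
  (k := fun z : borel X * borel X => \int[P z.1]_yt ell yt z.2)).
apply: (measurable_Rintegral_pullback_fst P
  (k := fun w : (borel X * borel X) * borel X => ell w.2 w.1.2)).
apply: (@measurableT_comp _ _ _ _ _ _
  (fun z : borel X * borel X => ell z.1 z.2) _
  (fun w : (borel X * borel X) * borel X => (w.2, w.1.2)) mell).
apply: measurable_fun_pair; first exact: measurable_snd.
exact: (measurableT_comp measurable_snd measurable_fst).
Qed.

(** Joint continuity speaks only of measures with finite moments; [P m] and [Q m] have them once
    their distances to the limits are below [delta], by [finite_moment_wasserstein]. *)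
Lemma wasserstein_continuous_cvg (R : realType) (X : completeMetricType R)
    (Xsep : separable X) (p : R) (x0 : X)
    (Psi : {measure set (borel X) -> \bar R} ->
           {measure set (borel X) -> \bar R} -> R)
    (P Q : nat -> {measure set (borel X) -> \bar R})
    (P' Q' : {measure set (borel X) -> \bar R}) :
  1 <= p -> jointly_wasserstein_continuous p x0 Psi ->
  finite_moment_prob p x0 P' -> finite_moment_prob p x0 Q' ->
  (forall m, P m setT = 1%E) -> (forall m, Q m setT = 1%E) ->
  wasserstein p (P m) P' @[m --> \oo] --> 0%E ->
  wasserstein p (Q m) Q' @[m --> \oo] --> 0%E ->
  Psi (P m) (Q m) @[m --> \oo] --> Psi P' Q'.
Proof.
move=> p1 Psic P'p Q'p P1 Q1 PP' QQ'.
have small (u : (\bar R)^nat) (e : R) : 0 < e -> u m @[m --> \oo] --> 0%E ->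
    \forall m \near \oo, (u m < e%:E)%E.
  by move=> e0 u0; exact: (u0 _ (@nbhs_open_ereal_lt _ 0 (cst e) e0)).
apply/cvgrPdist_lt => e e0.
have [delta delta0 Psid] := Psic P' Q' P'p Q'p e e0.
near=> m; rewrite distrC.
have Pd : (wasserstein p (P m) P' < delta%:E)%E by near: m; exact: small.
have Qd : (wasserstein p (Q m) Q' < delta%:E)%E by near: m; exact: small.
apply: Psid => //.
- by apply: (finite_moment_wasserstein Xsep p1 P'p (P1 m));
  rewrite (lt_trans Pd)// ltry.
- by apply: (finite_moment_wasserstein Xsep p1 Q'p (Q1 m));
  rewrite (lt_trans Qd)// ltry.
Unshelve. all: by end_near. Qed.

Theorem mainTheorem3 (R : realType)
  (* the Polish metric space, its reference point and the exponent *)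
  (X : completeMetricType R) (Xsep : separable X) (x0 : X)
  (p : R) (p_ge1 : 1 <= p)
  (* the measure-preserving system on the full state space *)
  (dS : measure_display) (S : measurableType dS) (mu : probability S R)
  (Phi : {mfun S >-> S}) (Phi_mu : measure_eq (distribution mu Phi) mu)
  (* the coarse-graining map *)
  (cg : {mfun S >-> borel X}) :
  let mubar := [the probability (borel X) R of distribution mu cg] in
  finite_moment_prob p x0 mubar ->
  forall
  (* the full trajectory, with the state at time n distributed as mu *)
  (dO : measure_display) (Omega : measurableType dO) (PP : probability Omega R)
  (n : nat) (x : nat -> {RV PP >-> S})
  (x_step : forall k w, x k.+1 w = Phi (x k w))
  (x_mu : measure_eq (distribution PP (x n)) mu),
  let xbar (k : nat) (w : Omega) : borel X := cg (x k w) in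
  forall
  (Q : nat -> R.-pker (borel X) ~> (borel X))
  (Q_law : forall m, (0 < m)%N ->
    regular_cond_distribution PP (xbar n) (xbar (n + m)%N) (Q m))
  (Q_cvg : {ae mubar, forall xn,
    wasserstein p (Q m xn) mubar @[m --> \oo] --> 0%E})
  (* the Markovian model *)
  (Theta : Type) (dE : measure_display) (E : measurableType dE)
  (F : Theta -> {mfun (borel X * E)%type >-> borel X}) (theta : Theta)
  (xi : nat -> {RV PP >-> E})
  (xi_indep : mutually_independent PP
    (state_noise_sigma (x n) (fun k => xi (n + k)%N)))
  (xt : nat -> {RV PP >-> borel X})
  (xt_init : forall w, xt n w = xbar n w)
  (xt_step : forall k w,
    xt (n + k).+1 w = F theta (xt (n + k)%N w, xi (n + k)%N w))
  (Pt : nat -> R.-pker (borel X) ~> (borel X))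
  (Pt_law : forall m, (0 < m)%N ->
    regular_cond_distribution PP (xbar n) (xt (n + m)%N) (Pt m))
  (Pt_moment : forall m, (0 < m)%N ->
    {ae mubar, forall xn, finite_moment_prob p x0 (Pt m xn)})
  (Pinf : borel X -> probability (borel X) R)
  (Pinf_moment : {ae mubar, forall xn, finite_moment_prob p x0 (Pinf xn)})
  (Pt_cvg : {ae mubar, forall xn,
    wasserstein p (Pt m xn) (Pinf xn) @[m --> \oo] --> 0%E})
  (* the loss *)
  (ell : X -> X -> R)
  (ell_cont : continuous (fun z : X * X => ell z.1 z.2))
  (C : R) (C_gt0 : 0 < C)
  (ell_growth : forall yt yb,
    `|ell yt yb| <= C * (1 + mdist yt x0 `^ p + mdist yb x0 `^ p))
  (ell_joint : jointly_wasserstein_continuous p x0 (expected_loss ell)),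
  let Risk (c : X) : R := \int[mubar]_yb ell c yb in
  forall (cstar : X) (cstar_min : unique_minimizer Risk cstar),
  let g (m : nat) (xn : borel X) : R := expected_loss ell (Pt m xn) (Q m xn) in
  let J (m : nat) : \bar R := ('E_mubar[g m])%E in
  uniformly_integrable mubar [set m | (0 < m)%N] g ->
  [/\ J m @[m --> \oo] --> ('E_mubar[fun xn => (\int[Pinf xn]_yt Risk yt)%R])%E,
      ((Risk cstar)%:E <= limn J)%E
    & limn J = (Risk cstar)%:E <->
      {ae mubar, forall xn, measure_eq (Pinf xn) \d_(cstar : borel X)}].
Proof.
move=> mubar mubarp dO Omega PP n x _ _ xbar Q _ Q_cvg Theta dE E F theta xi _ xt _
  _ Pt _ Pt_moment Pinf Pinf_moment Pt_cvg ell ell_cont C C_gt0 ell_growth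
  ell_joint Risk cstar cstar_min g J ui.
pose h (xn : borel X) := \int[Pinf xn]_yt Risk yt.
have mell := measurable_loss Xsep ell_cont.
have mg m : measurable_fun setT (g m).
  exact: measurable_expected_loss.
(* Uniform integrability is assumed for positive [m] only; the shift to [m.+1] turns the index set
   into all of [nat]. *)
have g_cvg : {ae mubar, forall xn, g m.+1 xn @[m --> \oo] --> h xn}.
  apply: filterS3 Q_cvg Pt_cvg Pinf_moment.
  move=> xn Qxn Ptxn Pinfm.
  rewrite /h -(expected_loss_risk Xsep ell_cont C_gt0 ell_growth Pinfm mubarp).
  apply: (wasserstein_continuous_cvg Xsep p_ge1 ell_joint Pinfm mubarp).
  - by move=> m; exact: prob_kernel.
  - by move=> m; exact: prob_kernel.
  - by rewrite -cvg_shiftS in Ptxn.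
  - by rewrite -cvg_shiftS in Qxn.
have ui' : uniformly_integrable mubar setT (fun m => g m.+1).
  by move=> e e0; have [M gM] := ui e e0; exists M => m _; exact: gM.
(* [Pinf] is a plain function, not a kernel, so [h] is not known to be measurable; [h'] is an
   integrable version of it. *)
have [h' [inth' hh' cvgJ]] := vitali_cvg (fun m => mg m.+1) ui' g_cvg.
have EhE : ('E_mubar[h] = \int[mubar]_xn (h' xn)%:E)%E.
  have [N [mN N0 subN]] := hh'.
  rewrite unlock; apply: (eq_integral_conull mN N0) => xn Nxn; congr EFin.
  by apply: contrapT => hxn; apply: Nxn; exact: subN.
have J_cvg : J m @[m --> \oo] --> ('E_mubar[h])%E.
  by rewrite -cvg_shiftS EhE /J unlock; exact: cvgJ.
have limJ : limn J = (\int[mubar]_xn h' xn)%:E.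
  rewrite fineK; last exact: integrable_fin_num inth'.
  by rewrite -EhE; exact: cvg_lim J_cvg.
have risk_int : {ae mubar, forall xn,
    (Pinf xn).-integrable setT (EFin \o (Risk : borel X -> R))}.
  apply: filterS Pinf_moment => xn Pinfm.
  exact: (integrable_risk Xsep ell_cont C_gt0 ell_growth Pinfm mubarp).
have h'_ge : {ae mubar, forall xn, Risk cstar <= h' xn}.
  apply: filterS2 risk_int hh' => xn rint <-.
  exact: Rintegral_ge_minimum.
split => //; first by rewrite limJ lee_fin; exact: Rintegral_ge_cst.
rewrite limJ; split=> [[eqR]|Pdirac].
  (* A mean equal to the lower bound of [h'] forces [h'] to be constant almost everywhere; the
     equality case for each [Pinf xn] then applies. *)
  have h'E := Rintegral_eq_lower_bound inth' h'_ge eqR.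
  apply: filterS3 risk_int hh' h'E => xn rint hxn h'xn.
  by apply/(Rintegral_eq_minimum rint cstar_min); rewrite -h'xn -hxn.
(* Writing the constant as its own mean reduces the converse to almost everywhere equality of
   integrands. *)
congr EFin; have -> : Risk cstar = \int[mubar]_xn Risk cstar.
  by rewrite Rintegral_cst// [X in fine X](@probability_setT _ _ _ mubar) mulr1.
rewrite /Rintegral; congr fine; apply: ae_eq_integral => //.
- by have /integrableP[] := inth'.
apply: filterS3 risk_int hh' Pdirac => xn rint hxn Pxn _.
by congr EFin; rewrite -hxn; apply/(Rintegral_eq_minimum rint cstar_min).
Qed.
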